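(* Let $\ell\ge 1$ be an integer, $\zeta>0$ and $k\ge0$ an integer. (i) The three-term recurrence relations $$\frac{2\ell-1}{2\ell+1}(x^2-1)P_{k}^{(\ell)}=p_{k}^{(\ell)}P_{k}^{(\ell-1)}+q_{k}^{(\ell)}P_{k+1}^{(\ell-1)}+r_{k+1}^{(\ell)}P_{k+2}^{(\ell-1)},$$ $$P_{k+1}^{(\ell-1)}=r_{k}^{(\ell)}P_{k-1}^{(\ell)}+q_{k}^{(\ell)}P_{k}^{(\ell)}+p_{k+1}^{(\ell)}P_{k+1}^{(\ell)}$$ hold, or in matrix-vector form $$\vec{P}_{k+1}^{(\ell-1)}=(\tilde{J}_{k}^{(\ell)})^{T}\vec{P}_{k}^{(\ell)}+p_{k+1}^{(\ell)}P_{k+1}^{(\ell)}\vec{e}_{k+2},\qquad \frac{2\ell-1}{2\ell+1}(x^2-1)\vec{P}_{k}^{(\ell)}=\tilde{J}_{k}^{(\ell)}\vec{P}_{k+1}^{(\ell-1)}+r_{k+1}^{(\ell)}P_{k+2}^{(\ell-1)}\vec{e}_{k+1},$$ where $$p_{k}^{(\ell)}:=\frac{c_{k}^{(\ell-1)}}{c_{k}^{(\ell)}},\qquad r_{k}^{(\ell)}:=\frac{2\ell-1}{2\ell+1}\frac{c_{k-1}^{(\ell)}}{c_{k+1}^{(\ell-1)}},$$ $$q_{k}^{(\ell)}:=\frac{2\ell-1}{2\ell+1}\frac{c_{k}^{(\ell)}}{c_{k+1}^{(\ell-1)}}\left(\sum_{i=1}^{k+2}x_{i,k+2}^{(\ell-1)}-\sum_{i=1}^{k}x_{i,k}^{(\ell)}\right)=\frac{c_{k+1}^{(\ell-1)}}{c_{k}^{(\ell)}}\sum_{i=1}^{k+1}\left(x_{i,k+1}^{(\ell)}-x_{i,k+1}^{(\ell-1)}\right),$$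 and $\tilde J_k^{(\ell)}\in\mathbb{R}^{(k+1)\times(k+2)}$ is the matrix (rows indexed $0,\dots,k$, columns indexed $0,\dots,k+1$) whose row $i$ has entries $p_i^{(\ell)}$, $q_i^{(\ell)}$, $r_{i+1}^{(\ell)}$ in columns $i,i+1,i+2$ respectively (the last entry being absent for $i=k$) and zeros elsewhere. (ii) The two-term recurrence relations $$\frac{2\ell-1}{2\ell+1}(x^2-1)P_{k}^{(\ell)}=\tilde{p}_{k}^{(\ell)}(x+\tilde{q}_{k}^{(\ell)})P_{k+1}^{(\ell-1)}+\tilde{r}_{k}^{(\ell)}P_{k}^{(\ell-1)},$$ $$P_{k+1}^{(\ell-1)}=\frac{2\ell-1}{2\ell+1}\frac{1}{\tilde{p}_{k}^{(\ell)}}(x-\tilde{q}_{k}^{(\ell)})P_{k}^{(\ell)}-\frac{a_{k-1}^{(\ell)}}{a_{k}^{(\ell-1)}}\tilde{r}_{k}^{(\ell)}P_{k-1}^{(\ell)}$$ hold, where $$\tilde{p}_{k}^{(\ell)}:=\frac{2\ell-1}{2\ell+1}\frac{c_{k}^{(\ell)}}{c_{k+1}^{(\ell-1)}},\qquad \tilde{q}_{k}^{(\ell)}:=\sum_{i=1}^{k+1}x_{i,k+1}^{(\ell-1)}-\sum_{i=1}^{k}x_{i,k}^{(\ell)},\qquad \tilde{r}_{k}^{(\ell)}:=p_{k}^{(\ell)}\left(1-\frac{2\ell+1}{2\ell-1}(\tilde{p}_{k}^{(\ell)})^{2}\right).$$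
   Context: For $\zeta>0$ and an integer $\ell\ge0$, $\omega^{(\ell)}(x;\zeta)=\frac{\zeta(x^2-1)^{\ell+1/2}}{(2\ell+1)K_{2}(\zeta)}e^{-\zeta x}$ on $[1,+\infty)$, where $K_\nu$ is the modified Bessel function of the second kind, and $(f,g)_{\omega^{(\ell)}}=\int_1^\infty fg\,\omega^{(\ell)}(x;\zeta)\,dx$. $\{P_k^{(\ell)}(x;\zeta)\}_{k\ge0}$ are the orthonormal polynomials for this inner product: $\deg P_k^{(\ell)}=k$, $(P_i^{(\ell)},P_k^{(\ell)})_{\omega^{(\ell)}}=\delta_{i,k}$, with leading coefficient $c_k^{(\ell)}>0$. The zeros of $P_k^{(\ell)}(\cdot;\zeta)$ are real, simple, lie in $(1,+\infty)$, and are denoted $x_{1,k}^{(\ell)}<\dots<x_{k,k}^{(\ell)}$. $a_k^{(\ell)}:=c_k^{(\ell)}/c_{k+1}^{(\ell)}$. $\vec P_k^{(\ell)}:=(P_0^{(\ell)},\dots,P_k^{(\ell)})^T$, and $\vec e_{j}$ is the last column of the identity matrix of order $j$. Conventions: $P_{-1}^{(\ell)}=0$, $c_{-1}^{(\ell)}=0$ (so $r_0^{(\ell)}=0$, $a_{-1}^{(\ell)}=0$). *)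

(* Defs.v *)
From mathcomp Require Import all_boot all_order all_algebra.
From mathcomp Require Import polyrcf.
From mathcomp Require Import all_classical all_reals all_analysis.
Import Order.TTheory GRing.Theory Num.Theory.
Import numFieldNormedType.Exports.

Set Implicit Arguments.
Unset Strict Implicit.
Unset Printing Implicit Defensive.

Local Open Scope classical_set_scope.
Local Open Scope ring_scope.

Definition cosh (R : realType) (t : R) : R := (expR t + expR (- t)) / 2.

(* K_nu(z) for z > 0, by the integral representation
   K_nu(z) = \int_0^oo exp(-z cosh t) cosh(nu t) dt. *)
Definition besselK (R : realType) (nu z : R) : R :=
  \int[lebesgue_measure]_(t in `[0, +oo[) (expR (- (z * cosh t)) * cosh (nu * t)).

Definition weight (R : realType) (zeta : R) (l : nat) (x : R) : R :=
  zeta * (x ^+ 2 - 1) `^ (l%:R + 2^-1)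
    / ((2 * l%:R + 1) * besselK 2 zeta) * expR (- (zeta * x)).

Definition inner (R : realType) (zeta : R) (l : nat) (f g : R -> R) : R :=
  \int[lebesgue_measure]_(x in `[1, +oo[) (f x * g x * weight zeta l x).

Definition orthonormal_polys (R : realType) (zeta : R) (l : nat)
    (P : nat -> {poly R}) : Prop :=
  [/\ forall k, size (P k) = k.+1,
      forall k, 0 < lead_coef (P k)
    & forall i k, inner zeta l (horner (P i)) (horner (P k)) = (i == k)%:R].

(* u_{k-1}, with the convention u_{-1} = 0. *)
Definition prev0 (V : nmodType) (u : nat -> V) (k : nat) : V :=
  if k is j.+1 then u j else 0.

(* Below, P l k is the polynomial P_k^{(l)}, and superscripts come first in
   all argument lists. Coefficients involving P^{(l-1)} are used for l >= 1. *)

Definition lc (R : realType) (P : nat -> nat -> {poly R}) (l k : nat) : R :=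
  lead_coef (P l k).

Definition acoef (R : realType) (P : nat -> nat -> {poly R}) (l k : nat) : R :=
  lc P l k / lc P l k.+1.

(* x_{i,k}^{(l)}, 1 <= i <= k: rootsR lists the distinct real roots of a
   polynomial in increasing order, indexed from 0. *)
Definition pzero (R : realType) (P : nat -> nat -> {poly R}) (l i k : nat) : R :=
  nth 0 (rootsR (P l k)) i.-1.

Definition lfrac (R : realType) (l : nat) : R :=
  (2 * l%:R - 1) / (2 * l%:R + 1).

Definition pcoef (R : realType) (P : nat -> nat -> {poly R}) (l k : nat) : R :=
  lc P l.-1 k / lc P l k.

Definition rcoef (R : realType) (P : nat -> nat -> {poly R}) (l k : nat) : R :=
  lfrac R l * (prev0 (lc P l) k / lc P l.-1 k.+1).

Definition qcoef (R : realType) (P : nat -> nat -> {poly R}) (l k : nat) : R :=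
  lfrac R l * (lc P l k / lc P l.-1 k.+1)
    * (\sum_(1 <= i < k.+3) pzero P l.-1 i k.+2
       - \sum_(1 <= i < k.+1) pzero P l i k).

Definition Jtilde (R : realType) (P : nat -> nat -> {poly R}) (l k : nat) :
    'M[R]_(k.+1, k.+2) :=
  \matrix_(i < k.+1, j < k.+2)
    if (j == i :> nat) then pcoef P l i
    else if (j == i.+1 :> nat) then qcoef P l i
    else if (j == i.+2 :> nat) then rcoef P l i.+1
    else 0.

Definition Pvec (R : realType) (P : nat -> nat -> {poly R}) (l k : nat) :
    'cV[{poly R}]_k.+1 :=
  \col_(i < k.+1) P l i.

Definition last_col (A : pzSemiRingType) (n : nat) : 'cV[A]_n.+1 :=
  col ord_max 1%:M.

Definition ptilde (R : realType) (P : nat -> nat -> {poly R}) (l k : nat) : R :=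
  lfrac R l * (lc P l k / lc P l.-1 k.+1).

Definition qtilde (R : realType) (P : nat -> nat -> {poly R}) (l k : nat) : R :=
  \sum_(1 <= i < k.+2) pzero P l.-1 i k.+1 - \sum_(1 <= i < k.+1) pzero P l i k.

Definition rtilde (R : realType) (P : nat -> nat -> {poly R}) (l k : nat) : R :=
  pcoef P l k
    * (1 - (2 * l%:R + 1) / (2 * l%:R - 1) * ptilde P l k ^+ 2).

(* Main.v *)
Require Import Defs.
From HB Require Import structures.
From mathcomp Require Import all_boot all_order all_algebra.
From mathcomp Require Import polyrcf.
From mathcomp Require Import all_classical all_reals all_analysis.
From mathcomp Require Import measurable_realfun zify ring lra.
Import Order.TTheory GRing.Theory Num.Theory.
Local Open Scope ring_scope.

Set Implicit Arguments.
Unset Strict Implicit.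
Unset Printing Implicit Defensive.

(** The three facts behind the relations are that integration against the
    weight is a positive linear functional on polynomials, that raising the
    superscript from l - 1 to l multiplies the weight by
    lfrac l * (x ^ 2 - 1) ([weight_succ]), and that the coefficient below the
    leading one of an orthogonal polynomial is, up to sign, its leading
    coefficient times the sum of its zeros ([coef_subtop]).

    Write P for the family of superscript l, Q for the one of superscript
    l - 1, and L, M for the corresponding functionals, so that
    L f = M (lfrac l * (x ^ 2 - 1) * f).  Then the numbers L (P_k * Q_j) are
    at the same time the coefficients of lfrac l * (x ^ 2 - 1) * P_k in the
    basis Q and those of Q_j in the basis P; they vanish unless
    k <= j <= k + 2, for degree reasons on both sides.  So one banded matrix,
    [Jtilde], governs both three-term relations.  Its outer diagonals are
    quotients of leading coefficients, and its middle diagonal is found by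
    comparing the coefficients below the leading ones, which brings in the
    sums of zeros.

    For the two-term relations, the announced multiple of (x + q) Q_(k+1)
    (resp. (x - q) P_k) is chosen to cancel the two highest coefficients of
    the left-hand side.  The difference has such a low degree, and is
    orthogonal to so many members of the basis, that a single term of its
    expansion survives.

    Two points need care.  Linearity of the integral requires all polynomials
    to be integrable against the weight: this follows from orthonormality
    itself, because the real-valued integral of a nonnegative function is 0
    when the integral diverges, whereas the squares of the P_i have integral 1
    ([integrable_poly]).  And the list of real roots of P_k must have k entries
    ([prod_XsubC_rootsR]): otherwise P_k times the product of the
    linear factors at its sign changes would be a semidefinite polynomial with
    zero integral. *)

(** * Expansions in an orthonormal family of polynomials *)

Lemma graded_basis_span (F : fieldType) (Q : nat -> {poly F}) n (f : {poly F}) :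
  (forall k, size (Q k) = k.+1) -> (size f <= n)%N ->
  exists a : nat -> F, f = \sum_(j < n) a j *: Q j.
Proof.
move=> sQ; elim: n f => [|n IHn] f sf.
  by exists (fun=> 0); move: sf; rewrite leqn0 size_poly_eq0 big_ord0 => /eqP.
have lQ : (Q n)`_n != 0.
  rewrite -[n in _`_n]/(n.+1.-1) -(sQ n) -lead_coefE lead_coef_eq0.
  by rewrite -size_poly_eq0 sQ.
pose b := f`_n / (Q n)`_n.
have [|a gE] := IHn (f - b *: Q n).
  apply/leq_sizeP => j; rewrite leq_eqVlt coefB coefZ => /predU1P[<-|nj].
    by rewrite divfK // subrr.
  rewrite [(Q n)`_j]nth_default ?sQ // mulr0 subr0.
  by move/leq_sizeP: sf; apply.
exists (fun j => if j == n then b else a j).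
rewrite big_ord_recr /= eqxx -[LHS](subrK (b *: Q n)) gE; congr (_ + _).
by apply: eq_bigr => j _; rewrite ltn_eqF.
Qed.

Definition orthonormal_for (R : numFieldType) (L : {scalar {poly R}})
    (Q : nat -> {poly R}) : Prop :=
  [/\ forall k, size (Q k) = k.+1,
      forall k, 0 < lead_coef (Q k)
    & forall i k, L (Q i * Q k) = (i == k)%:R].

Section OrthonormalExpansion.
Variables (R : rcfType) (L : {scalar {poly R}}) (Q : nat -> {poly R}).
Hypothesis onQ : orthonormal_for L Q.

Lemma coef_top k : (Q k)`_k = lead_coef (Q k).
Proof. by case: onQ => sQ _ _; rewrite lead_coefE sQ. Qed.

Lemma lead_neq0 k : lead_coef (Q k) != 0.
Proof. by case: onQ => _ lQ _; rewrite gt_eqF. Qed.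

Lemma coef_gt k j : (k < j)%N -> (Q k)`_j = 0.
Proof. by move=> kj; apply: nth_default; case: onQ => ->. Qed.

Lemma expansion n (f : {poly R}) : (size f <= n)%N ->
  f = \sum_(j < n) L (f * Q j) *: Q j.
Proof.
case: onQ => sQ _ oQ.
move=> /(graded_basis_span sQ) [a fE].
rewrite {1}fE; apply: eq_bigr => k _; congr (_ *: _).
rewrite fE mulr_suml linear_sum (bigD1 k) //= big1 => [|j jk].
  by rewrite -scalerAl linearZ /= oQ eqxx mulr1 addr0.
by rewrite -scalerAl linearZ /= oQ (negPf (jk : j != k :> nat)) mulr0.
Qed.

Lemma expansion_from m n (f : {poly R}) : (size f <= n)%N -> (m <= n)%N ->
  (forall j, (j < m)%N -> L (f * Q j) = 0) ->
  f = \sum_(m <= j < n) L (f * Q j) *: Q j.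
Proof.
move=> sf mn f0; rewrite {1}(expansion sf).
rewrite -(big_mkord xpredT (fun j => L (f * Q j) *: Q j)) /=.
rewrite (big_cat_nat _ (n := m)) //= big_nat_cond big1 ?add0r // => j.
by rewrite andbT => /f0 ->; rewrite scale0r.
Qed.

(** Expanding f in the basis, only the term in Q_k reaches degree k. *)
Lemma moment_top k (f : {poly R}) : (size f <= k.+1)%N ->
  L (f * Q k) = f`_k / lead_coef (Q k).
Proof.
move=> /expansion fE; rewrite {2}fE coef_sum big_ord_recr /= big1 ?add0r.
  by rewrite coefZ coef_top mulfK // lead_neq0.
by move=> j _; rewrite coefZ coef_gt ?mulr0 //=.
Qed.

Lemma moment_lower k (f : {poly R}) : (size f <= k)%N -> L (f * Q k) = 0.
Proof.
move=> sf; rewrite moment_top ?(leq_trans sf) //.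
by rewrite nth_default // mul0r.
Qed.

Lemma moment_sqr_gt0 (f : {poly R}) : f != 0 -> 0 < L (f * f).
Proof.
move=> f0; have fE := expansion (leqnn (size f)).
have LE : L (f * f) = \sum_(j < size f) L (f * Q j) ^+ 2.
  rewrite {2}fE mulr_sumr linear_sum; apply: eq_bigr => j _.
  by rewrite -scalerAr linearZ.
have sq_ge0 (j : 'I_(size f)) : true -> 0 <= L (f * Q j) ^+ 2.
  by rewrite sqr_ge0.
rewrite LE lt_def sumr_ge0 // andbT; apply: contra f0.
rewrite psumr_eq0 // => /allP s0; apply/eqP; rewrite fE big1 // => j _.
have := s0 j; rewrite mem_index_enum sqrf_eq0 => /(_ isT) /= /eqP ->.
by rewrite scale0r.
Qed.

Hypothesis L_ge0 : forall f : {poly R}, (forall x, 0 <= f.[x]) -> 0 <= L f.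

(** If L f vanished for some nonzero f >= 0, then L (f * (1 + t f) ^ 2) >= 0
    would read 2 t L (f ^ 2) + t ^ 2 L (f ^ 3) >= 0 for all t, which fails for
    small negative t because L (f ^ 2) > 0.  Strict positivity thus needs no
    argument about null sets. *)
Lemma moment_gt0 (f : {poly R}) : f != 0 -> (forall x, 0 <= f.[x]) -> 0 < L f.
Proof.
move=> f0 f_ge0; rewrite lt_def L_ge0 // andbT.
apply/eqP => Lf0.
have Lff := moment_sqr_gt0 f0.
set a := L (f * f) in Lff; set b := L (f * f * f).
have ineq t : 0 <= t * (2 * a + t * b).
  have : 0 <= L (f * ((1 + t *: f) * (1 + t *: f))).
    by apply: L_ge0 => x; rewrite !hornerM mulr_ge0 // -expr2 sqr_ge0.
  have -> : f * ((1 + t *: f) * (1 + t *: f)) =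
      f + (2 * t) *: (f * f) + (t * t) *: (f * f * f).
    by rewrite -!mul_polyC !polyCM; ring.
  rewrite !linearD !linearZ /= Lf0 -/a -/b add0r.
  by have -> : 2 * t * a + t * t * b = t * (2 * a + t * b) by ring.
(* The value of t makes |t * b| < a, so that 2 * a + t * b > 0. *)
pose t := - a / (`|b| + a).
have d_gt0 : 0 < `|b| + a by rewrite ltr_wpDl.
have t_lt0 : t < 0 by rewrite /t mulNr oppr_lt0 divr_gt0.
have := ineq t; rewrite leNgt => /negP; apply.
rewrite nmulr_rlt0 //.
have tb : - a < t * b + a.
  have -> : t * b + a = (a * (`|b| - b) + a * a) / (`|b| + a).
    by rewrite /t; field; rewrite gt_eqF.
  apply: (@lt_le_trans _ _ 0); first by rewrite oppr_lt0.
  by rewrite divr_ge0 ?addr_ge0 ?mulr_ge0 ?subr_ge0 ?ler_norm // ltW.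
lra.
Qed.

End OrthonormalExpansion.

(** * Zeros of orthogonal polynomials *)

Section Zeros.
Variable R : rcfType.

Lemma rootless_sign (p : {poly R}) : (forall x, ~~ root p x) ->
  (forall x, 0 <= p.[x]) \/ (forall x, p.[x] <= 0).
Proof.
move=> noroot.
have same x y : 0 <= p.[x] * p.[y].
  rewrite leNgt; apply/negP => neg.
  wlog xy : x y neg / x <= y => [hwlog|].
    case/orP: (le_total x y) => xy; first exact: (hwlog x y).
    by apply: (hwlog y x); rewrite // mulrC.
  by have [z _ rz] := poly_ivtoo xy neg; move: (noroot z); rewrite rz.
have [p0|p0] := ltP 0 p.[0]; [left|right] => x.
  by rewrite -(pmulr_rge0 _ p0).
have {}p0 : p.[0] < 0 by rewrite lt_neqAle p0 andbT; exact: noroot.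
by rewrite -(nmulr_rge0 _ p0).
Qed.

(** Real roots are split off one at a time: a root that is already in zs is
    removed from it and leaves a square in the semidefinite factor s.  So zs
    ends up with the roots of odd multiplicity, where p changes sign. *)
Lemma sign_change_factor (p : {poly R}) : exists s (zs : seq R),
  [/\ uniq zs, p = s * \prod_(z <- zs) ('X - z%:P)
    & (forall x, 0 <= s.[x]) \/ (forall x, s.[x] <= 0)].
Proof.
have [n] := ubnP (size p); elim: n p => // n IHn p sp.
have [->|p0] := eqVneq p 0.
  by exists 0, [::]; split=> //; [rewrite mul0r|left=> x; rewrite horner0].
case E: (rootsR p) => [|z rs].
  exists p, [::]; split; rewrite ?big_nil ?mulr1 //; apply: rootless_sign => x.
  by apply/negP => rx; have := roots_on_rootsR p0 x; rewrite inE rx E.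
have rz : root p z by have := roots_on_rootsR p0 z; rewrite inE E mem_head /=.
case/factor_theorem: rz => q pE.
have q0 : q != 0 by apply: contraNneq p0 => q0; rewrite pE q0 mul0r.
have sq : (size q < n)%N.
  by move: sp; rewrite pE size_Mmonic ?monicXsubC // size_XsubC addn2.
have [s [zs [uzs qE sgn]]] := IHn q sq.
have [zin|znin] := boolP (z \in zs); last first.
  exists s, (z :: zs); split=> //=; first by rewrite znin.
  by rewrite big_cons pE {1}qE; ring.
exists (s * ('X - z%:P) ^+ 2), (rem z zs); split; first exact: rem_uniq.
  by rewrite pE {1}qE (big_rem z) //=; ring.
by case: sgn => sgn; [left|right] => x; rewrite hornerM horner_exp;
  [rewrite mulr_ge0 ?sqr_ge0|rewrite mulr_le0_ge0 ?sqr_ge0].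
Qed.

Variables (L : {scalar {poly R}}) (Q : nat -> {poly R}).
Hypothesis onQ : orthonormal_for L Q.
Hypothesis L_ge0 : forall f : {poly R}, (forall x, 0 <= f.[x]) -> 0 <= L f.

(** With Q_k = s * m, where m is the product of the k' linear factors at the
    sign changes, m * Q_k = s * m ^ 2 is semidefinite and nonzero.  If k' < k
    then L (m * Q_k) = 0 by orthogonality, contradicting strict positivity. *)
Lemma prod_XsubC_rootsR k :
  size (rootsR (Q k)) = k /\
  Q k = lead_coef (Q k) *: \prod_(z <- rootsR (Q k)) ('X - z%:P).
Proof.
have [sQ _ _] := onQ.
have Q0 : Q k != 0 by rewrite -lead_coef_eq0 (lead_neq0 onQ).
have [s [zs [uzs QE sgn]]] := sign_change_factor (Q k).
set m := \prod_(z <- zs) _ in QE.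
have sm : size m = (size zs).+1 by rewrite size_prod_XsubC.
have zsQ : all (root (Q k)) zs.
  apply/allP => z zin; rewrite QE rootM root_prod_XsubC zin orbT.
  by [].
have szs : size zs = k.
  have kle : (size zs <= k)%N.
    by have := max_poly_roots Q0 zsQ uzs; rewrite sQ.
  apply/eqP; rewrite eqn_leq kle leqNgt; apply/negP => klt.
  have Lm : L (m * Q k) = 0 by apply: (moment_lower onQ); rewrite sm.
  have QmE : m * Q k = s * (m ^+ 2) by rewrite QE; ring.
  have Qm0 : m * Q k != 0 by rewrite mulf_neq0 // -size_poly_eq0 sm.
  have mge x : 0 <= (m ^+ 2).[x] by rewrite horner_exp sqr_ge0.
  case: sgn => sgn.
    suff: 0 < L (m * Q k) by rewrite Lm ltxx.
    apply: (moment_gt0 onQ L_ge0 Qm0) => x.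
    by rewrite QmE hornerM mulr_ge0.
  have Nm0 : - (m * Q k) != 0 by rewrite oppr_eq0.
  suff: 0 < L (- (m * Q k)) by rewrite linearN /= Lm oppr0 ltxx.
  apply: (moment_gt0 onQ L_ge0 Nm0) => x.
  by rewrite QmE hornerN hornerM oppr_ge0 mulr_le0_ge0.
have urs : uniq (rootsR (Q k)) by exact: polyrcf.uniq_roots.
have rsQ : all (root (Q k)) (rootsR (Q k)).
  by apply/allP => z zin; have := roots_on_rootsR Q0 z; rewrite inE zin.
have srs : size (rootsR (Q k)) = k.
  apply/eqP; rewrite eqn_leq; apply/andP; split.
    by have := max_poly_roots Q0 rsQ urs; rewrite sQ.
  rewrite -{1}szs uniq_leq_size // => z /(allP zsQ) rz.
  by have := roots_on_rootsR Q0 z; rewrite inE rz => /= <-.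
split=> //; apply: all_roots_prod_XsubC; rewrite ?sQ ?srs //.
by rewrite uniq_rootsE.
Qed.

(** The factor 'X shifts coefficients by one, so that this form of Vieta's
    formula also covers k = 0. *)
Lemma coef_subtop k :
  ('X * Q k)`_k =
  - lead_coef (Q k) * \sum_(1 <= i < k.+1) nth 0 (rootsR (Q k)) i.-1.
Proof.
have [srs QE] := prod_XsubC_rootsR k.
have -> : \sum_(1 <= i < k.+1) nth 0 (rootsR (Q k)) i.-1 =
    \sum_(z <- rootsR (Q k)) z by rewrite [RHS](big_nth 0) srs big_add1.
rewrite coefXM.
case: k => [|k] /= in srs QE *.
  by rewrite (size0nil srs) big_nil mulr0.
have := @coefPn_prod_XsubC R (rootsR (Q k.+1)).
rewrite srs => /(_ isT) /= subtop.
by rewrite {1}QE coefZ subtop mulrN mulNr.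
Qed.

End Zeros.

(** * Integration against the weight *)

Section Moment.
Variables (R : realType) (zeta : R).
Local Open Scope classical_set_scope.
Local Notation mu := (@lebesgue_measure R).
Local Notation D := (`[1%R, +oo[%classic : set R).

Definition moment (l : nat) (f : {poly R}) : R :=
  \int[mu]_(x in D) (f.[x] * weight zeta l x).

Lemma moment_inner l (f g : {poly R}) :
  inner zeta l (horner f) (horner g) = moment l (f * g).
Proof. by apply: eq_Rintegral => x _; rewrite hornerM. Qed.

Lemma besselK_ge0 (nu z : R) : 0 <= besselK nu z.
Proof.
apply: Rintegral_ge0 => t _; rewrite mulr_ge0 ?expR_ge0 //.
by rewrite divr_ge0 // addr_ge0 ?expR_ge0.
Qed.

Hypothesis zeta_gt0 : 0 < zeta.

Lemma weight_ge0 l x : 0 <= weight zeta l x.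
Proof.
rewrite /weight mulr_ge0 ?expR_ge0 // divr_ge0 //.
  by rewrite mulr_ge0 ?powR_ge0 // ltW.
by rewrite mulr_ge0 ?besselK_ge0 // addr_ge0 // mulr_ge0.
Qed.

Lemma measurable_weight l : measurable_fun setT (weight zeta l).
Proof.
apply: measurable_funM.
  apply: measurable_funM => //; apply: measurable_funM => //.
  apply: (measurableT_comp (measurable_powR _)).
  by apply: measurable_funB => //; exact: measurable_funX.
by apply: measurableT_comp => //; apply: measurableT_comp.
Qed.

(** The exponent of (x ^ 2 - 1) goes up by 1, and the ratio of the normalising
    factors 1 / (2 l + 1) is [lfrac]; the Bessel factor is the same on both
    sides. *)
Lemma weight_succ l (x : R) : 1 <= x ->
  weight zeta l.+1 x = lfrac R l.+1 * ((x ^+ 2 - 1) * weight zeta l x).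
Proof.
move=> x1.
have y0 : 0 <= x ^+ 2 - 1 by rewrite subr_ge0 expr_ge1 // (le_trans ler01).
rewrite /weight /lfrac.
have -> : (x ^+ 2 - 1) `^ (l.+1%:R + 2^-1) =
    (x ^+ 2 - 1) * (x ^+ 2 - 1) `^ (l%:R + 2^-1).
  rewrite -[in LHS]natr1 addrAC addrC powRD ?powRr1 //.
  apply/implyP => /eqP E; have : 0 < 1 + (l%:R + 2^-1) :> R.
    by rewrite ltr_pwDl // addr_ge0 // invr_ge0.
  by rewrite E ltxx.
have -> : 2 * l.+1%:R - 1 = 2 * l%:R + 1 :> R by rewrite -natr1; ring.
set b := besselK 2 zeta; set p := _ `^ _; set e := expR _.
rewrite !invfM; set b' := b^-1; set d := (2 * l.+1%:R + 1)^-1.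
by field; rewrite gt_eqF // ltr_wpDl // mulr_ge0.
Qed.

Let mD : measurable (D : set (measurableTypeR R)).
Proof. exact: measurable_itv. Qed.

Lemma measurable_moment l (f : {poly R}) :
  measurable_fun D (fun x : R => f.[x] * weight zeta l x).
Proof.
apply: measurable_funM; first exact: measurable_poly.
by apply: measurable_funTS; exact: measurable_weight.
Qed.

(** [Rintegral] takes the value 0 on a divergent integral of a nonnegative
    function. *)
Lemma moment_neq0_integrable l (f : {poly R}) : (forall x, 0 <= f.[x]) ->
  moment l f != 0 -> mu.-integrable D (fun x => (f.[x] * weight zeta l x)%:E).
Proof.
move=> f0 mf; apply/integrableP; split.
  by apply/measurable_EFinP; exact: measurable_moment.
have -> : (\int[mu]_(x in D) `|(f.[x] * weight zeta l x)%:E| =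
    \int[mu]_(x in D) (f.[x] * weight zeta l x)%:E)%E.
  apply: eq_integral => x _; rewrite abse_EFin ger0_norm // mulr_ge0 //.
  exact: weight_ge0.
rewrite ltey; apply: contra mf => /eqP E.
by rewrite /moment /Rintegral E.
Qed.

Variables (l : nat) (Q : nat -> {poly R}).
Hypothesis oQ : orthonormal_polys zeta l Q.

(** The polynomials whose square is integrable form a vector space, by
    (g + h) ^ 2 <= 2 (g ^ 2 + h ^ 2).  It contains every Q_k, since the square
    of Q_k has the nonzero integral 1, hence it contains all polynomials; and
    f = ((f + 1) ^ 2 - (f - 1) ^ 2) / 4. *)
Lemma integrable_poly (f : {poly R}) :
  mu.-integrable D (EFin \o (fun x => f.[x] * weight zeta l x)).
Proof.
have [sQ lQ onQ] := oQ.
pose sq (g : {poly R}) :=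
  mu.-integrable D (fun x => (g.[x] ^+ 2 * weight zeta l x)%:E).
have sqE g : sq g =
    mu.-integrable D (EFin \o (fun x => (g ^+ 2).[x] * weight zeta l x)).
  rewrite /sq; congr (mu.-integrable D _); apply/funext => x /=.
  by rewrite horner_exp.
have sqQ k : sq (Q k).
  rewrite sqE; apply: moment_neq0_integrable => [x|].
    by rewrite horner_exp sqr_ge0.
  by rewrite expr2 -moment_inner onQ eqxx oner_eq0.
have sqZ a g : sq g -> sq (a *: g).
  move=> sg; have := integrableZl mD (a ^+ 2) sg.
  rewrite /sq; congr (is_true (mu.-integrable D _)); apply/funext => x /=.
  by rewrite -EFinM hornerZ exprMn mulrA.
have sqD g h : sq g -> sq h -> sq (g + h).
  move=> sg sh; have := integrableZl mD 2 (integrableD mD sg sh).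
  apply: le_integrable => //.
    rewrite (_ : (fun _ => _) =
        EFin \o (fun x => ((g + h) ^+ 2).[x] * weight zeta l x)).
      by apply/measurable_EFinP; exact: measurable_moment.
    by apply/funext => x /=; rewrite horner_exp.
  move=> x _ /=; rewrite lee_fin.
  move: (weight zeta l x) (weight_ge0 l x) => w w0.
  rewrite -mulrDl !ger0_norm; 
    [|by rewrite !mulr_ge0 // addr_ge0 // sqr_ge0
     |by apply: mulr_ge0 => //; exact: sqr_ge0].
  rewrite mulrA ler_wpM2r // hornerD -subr_ge0.
  have -> : 2 * (g.[x] ^+ 2 + h.[x] ^+ 2) - (g.[x] + h.[x]) ^+ 2 =
      (g.[x] - h.[x]) ^+ 2 by ring.
  exact: sqr_ge0.
have sq_all (g : {poly R}) : sq g.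
  have [a ->] := graded_basis_span sQ (leqnn (size g)).
  elim/big_ind: _ => // [|i _]; last exact: sqZ.
  by rewrite -(scale0r (Q 0)); apply: sqZ.
have s1 := sq_all (f + 1).
have s2 := sq_all (f - 1).
have := integrableZl mD 4^-1 (integrableB mD s1 s2).
congr (is_true (mu.-integrable D _)); apply/funext => x /=.
move: (weight zeta l x) => w; rewrite !hornerE.
by rewrite -EFinB -EFinM; congr EFin; field.
Qed.

Lemma moment_linear : linear_for *%R (moment l).
Proof.
move=> a f g; rewrite /moment -RintegralZl //; last exact: integrable_poly.
rewrite -RintegralD //; last exact: integrable_poly.
  apply: eq_Rintegral => x _; move: (weight zeta l x) => w.
  by rewrite hornerD hornerZ /= mulrDl mulrA.
by have := integrableZl mD a (integrable_poly f); apply.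
Qed.

Lemma moment_functional :
  exists2 L : {scalar {poly R}}, L =1 moment l & orthonormal_for L Q.
Proof.
have [sQ lQ onQ] := oQ.
pose L : {scalar {poly R}} := HB.pack (moment l)
  (GRing.isLinear.Build R {poly R} R *%R (moment l) moment_linear).
by exists L => //; split=> // i k; rewrite -onQ moment_inner.
Qed.

Lemma moment_ge0 (m : nat) (f : {poly R}) :
  (forall x, 0 <= f.[x]) -> 0 <= moment m f.
Proof.
move=> f0; apply: Rintegral_ge0 => x _; apply: mulr_ge0 => //.
exact: weight_ge0.
Qed.

Lemma moment_succ (m : nat) (f : {poly R}) :
  moment m.+1 f = moment m (lfrac R m.+1 *: (('X^2 - 1) * f)).
Proof.
apply: eq_Rintegral => x; rewrite inE /= in_itv /= andbT => x1.
rewrite weight_succ //; move: (weight zeta m x) (lfrac R m.+1) => w c.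
rewrite !hornerE /=. by rewrite [_ * c]mulrC [c * _ * _]mulrAC.
Qed.

End Moment.

(** * Recurrence relations between two families with related functionals *)

Section Recurrences.
Variables (R : realType) (P : nat -> nat -> {poly R}) (l : nat).
Variables M L : {scalar {poly R}}.
Hypothesis l_ge1 : (1 <= l)%N.
Hypothesis onQ : orthonormal_for M (P l.-1).
Hypothesis onP : orthonormal_for L (P l).
Hypothesis M_ge0 : forall f : {poly R}, (forall x, 0 <= f.[x]) -> 0 <= M f.
Hypothesis L_ge0 : forall f : {poly R}, (forall x, 0 <= f.[x]) -> 0 <= L f.
Hypothesis LM : forall f, L f = M (lfrac R l *: (('X^2 - 1) * f)).

Local Notation Q := (P l.-1).
Local Notation lcP := (lc P l).
Local Notation lcQ := (lc P l.-1).

Let lcP0 k : lcP k != 0. Proof. exact: lead_neq0 onP k. Qed.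
Let lcQ0 k : lcQ k != 0. Proof. exact: lead_neq0 onQ k. Qed.
Let sizeP k : size (P l k) = k.+1. Proof. by case: onP. Qed.
Let sizeQ k : size (Q k) = k.+1. Proof. by case: onQ. Qed.
Let topP k : (P l k)`_k = lcP k. Proof. exact: coef_top onP k. Qed.
Let topQ k : (Q k)`_k = lcQ k. Proof. exact: coef_top onQ k. Qed.

Let sumP k := \sum_(1 <= i < k.+1) pzero P l i k.
Let sumQ k := \sum_(1 <= i < k.+1) pzero P l.-1 i k.
Let subtopP k : ('X * P l k)`_k = - lcP k * sumP k.
Proof. exact: coef_subtop onP L_ge0 k. Qed.
Let subtopQ k : ('X * Q k)`_k = - lcQ k * sumQ k.
Proof. exact: coef_subtop onQ M_ge0 k. Qed.

Lemma lfrac_terms_neq0 : (2 * l%:R - 1 != 0 :> R) /\ (2 * l%:R + 1 != 0 :> R).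
Proof.
have l1 : 1 <= l%:R :> R by rewrite ler1n.
by split; rewrite gt_eqF //; lra.
Qed.

Let X2P k : {poly R} := lfrac R l *: (('X^2 - 1) * P l k).

Let X2PE k : X2P k = lfrac R l *: ('X * ('X * P l k) - P l k).
Proof. by rewrite /X2P; congr (_ *: _); ring. Qed.

Let size_X2P k : (size (X2P k) <= k.+3)%N.
Proof.
apply/leq_sizeP => j kj; rewrite X2PE coefZ coefB !coefXM.
by case: j kj => [|[|j]] //= kj; rewrite !(coef_gt onP) ?subr0 ?mulr0 //; lia.
Qed.

(** This identity turns the coefficients of (x ^ 2 - 1) P_k in the basis Q
    into those of the Q_j in the basis P. *)
Lemma cross_moment k j : M (X2P k * Q j) = L (P l k * Q j).
Proof. by rewrite LM /X2P -scalerAl mulrA. Qed.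

Lemma cross_lower k j : (j < k)%N -> L (P l k * Q j) = 0.
Proof. by move=> jk; rewrite mulrC (moment_lower onP) // sizeQ. Qed.

Lemma cross_upper k j : (k.+2 < j)%N -> L (P l k * Q j) = 0.
Proof.
move=> kj; rewrite -cross_moment (moment_lower onQ) //.
by rewrite (leq_trans (size_X2P k)).
Qed.

Lemma cross_diag k : L (P l k * Q k) = pcoef P l k.
Proof. by rewrite mulrC (moment_top onP) ?sizeQ // topQ. Qed.

Lemma cross_super2 k : L (P l k * Q k.+2) = rcoef P l k.+1.
Proof.
rewrite -cross_moment (moment_top onQ) ?size_X2P // X2PE coefZ coefB !coefXM /=.
by rewrite /rcoef topP (coef_gt onP) // subr0 -mulrA.
Qed.

Lemma X2P_expansion k n : (k.+3 <= n)%N ->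
  X2P k = \sum_(j < n) L (P l k * Q j) *: Q j.
Proof.
move=> kn; rewrite {1}(expansion onQ (leq_trans (size_X2P k) kn)).
by apply: eq_bigr => j _; rewrite cross_moment.
Qed.

Lemma X2P_three_terms k : X2P k = L (P l k * Q k) *: Q k
  + L (P l k * Q k.+1) *: Q k.+1 + L (P l k * Q k.+2) *: Q k.+2.
Proof.
rewrite {1}(X2P_expansion (leqnn k.+3)) !big_ord_recr /= big1 ?add0r // => j _.
by rewrite cross_lower ?scale0r.
Qed.

(** The only entry of the band that is not a quotient of leading coefficients:
    it is read off the coefficient of degree k + 1 in the expansion of
    (x ^ 2 - 1) P_k, where Vieta's formula enters for P_k and Q_(k+2). *)
Lemma cross_super k : L (P l k * Q k.+1) = qcoef P l k.
Proof.
have /(congr1 (fun p : {poly R} => p`_k.+1)) := X2P_three_terms k.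
rewrite cross_super2 X2PE !coefD !coefZ coefB coefXM /=.
rewrite (coef_gt onP) // (coef_gt onQ) // topQ subtopP.
have := subtopQ k.+2; rewrite coefXM /= => ->.
rewrite /rcoef /qcoef -/(sumQ k.+2) -/(sumP k) /=.
set b := L (_ * Q k.+1) => E.
apply: (mulIf (lcQ0 k.+1)).
have -> : b * lcQ k.+1 = lfrac R l * (- lcP k * sumP k - 0) +
    lfrac R l * (lcP k / lcQ k.+2) * (lcQ k.+2 * sumQ k.+2).
  by rewrite E; ring.
by field; rewrite !lcQ0.
Qed.

Lemma JtildeE k (i : 'I_k.+1) (j : 'I_k.+2) :
  Jtilde P l k i j = L (P l i * Q j).
Proof.
rewrite mxE; case: ltngtP => [ji|ij|->]; last by rewrite cross_diag.
  by rewrite cross_lower // !ltn_eqF //; lia.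
case: eqVneq => [->|ij1]; first by rewrite cross_super.
case: eqVneq => [->|ij2]; first by rewrite cross_super2.
by rewrite cross_upper //; lia.
Qed.

Lemma Q_expansion m n : (m < n)%N ->
  Q m = \sum_(j < n) L (P l j * Q m) *: P l j.
Proof.
move=> mn; rewrite {1}(@expansion _ _ _ onP n (Q m)) ?sizeQ //.
by apply: eq_bigr => j _; rewrite mulrC.
Qed.

Lemma three_term_lower k : Q k.+1 =
  rcoef P l k *: prev0 (P l) k + qcoef P l k *: P l k
    + pcoef P l k.+1 *: P l k.+1.
Proof.
rewrite {1}(Q_expansion (leqnn k.+2)) !big_ord_recr /= cross_super cross_diag.
congr (_ + _ + _); case: k => [|k]; first by rewrite big_ord0 scaler0.
rewrite big_ord_recr /= cross_super2 big1 ?add0r // => j _.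
by rewrite cross_upper ?scale0r // !ltnS.
Qed.

Lemma three_term_upper k : lfrac R l *: (('X^2 - 1) * P l k) =
  pcoef P l k *: Q k + qcoef P l k *: Q k.+1 + rcoef P l k.+1 *: Q k.+2.
Proof.
by have := X2P_three_terms k; rewrite cross_diag cross_super cross_super2.
Qed.

(** The same entry, read off the coefficient of degree k in the dual
    expansion. *)
Lemma qcoef_lower k : qcoef P l k = lcQ k.+1 / lcP k
  * \sum_(1 <= i < k.+2) (pzero P l i k.+1 - pzero P l.-1 i k.+1).
Proof.
have /(congr1 (fun p : {poly R} => ('X * p)`_k.+1)) := three_term_lower k.
rewrite subtopQ !mulrDr !coefD -!scalerAr !coefZ subtopP sumrB.
rewrite -/(sumP k.+1) -/(sumQ k.+1) !coefXM /= topP.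
have -> : (prev0 (P l) k)`_k = 0.
  by case: k => [|k] /=; rewrite ?coef0 // (coef_gt onP).
rewrite mulr0 add0r /pcoef => E.
apply: (mulIf (lcP0 k)).
have -> : qcoef P l k * lcP k = - lcQ k.+1 * sumQ k.+1 +
    lcQ k.+1 / lcP k.+1 * (lcP k.+1 * sumP k.+1) by rewrite E; ring.
by field; rewrite !lcP0.
Qed.

Lemma vector_lower k : Pvec P l.-1 k.+1 =
  (map_mx polyC (Jtilde P l k))^T *m Pvec P l k
    + (pcoef P l k.+1 *: P l k.+1) *: last_col {poly R} k.+1.
Proof.
apply/matrixP => i j; rewrite !mxE (Q_expansion (ltn_ord i)) big_ord_recr /=.
congr (_ + _).
  by apply: eq_bigr => m _; rewrite !mxE -mul_polyC -JtildeE !mxE.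
have [->|ik] := eqVneq i ord_max; first by rewrite cross_diag mulr1.
rewrite mulr0 cross_lower ?scale0r // ltn_neqAle -ltnS ltn_ord andbT.
exact: ik.
Qed.

Lemma vector_upper k : (lfrac R l *: ('X^2 - 1)) *: Pvec P l k =
  map_mx polyC (Jtilde P l k) *m Pvec P l.-1 k.+1
    + (rcoef P l k.+1 *: Q k.+2) *: last_col {poly R} k.
Proof.
apply/matrixP => i j; rewrite !mxE -scalerAl -/(X2P i).
rewrite (@X2P_expansion i k.+3); last by have := ltn_ord i; lia.
rewrite big_ord_recr /=.
congr (_ + _).
  by apply: eq_bigr => m _; rewrite !mxE -mul_polyC -JtildeE !mxE.
have [->|ik] := eqVneq i ord_max; first by rewrite cross_super2 mulr1.
rewrite mulr0 cross_upper ?scale0r // !ltnS ltn_neqAle -ltnS ltn_ord andbT.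
exact: ik.
Qed.

(** The difference D has degree at most k, because the multiple of
    (x + q) Q_(k+1) matches the two highest coefficients, and it is orthogonal
    to Q_j for j < k; hence it is a multiple of Q_k. *)
Lemma two_term_upper k : lfrac R l *: (('X^2 - 1) * P l k) =
  ptilde P l k *: (('X + (qtilde P l k)%:P) * Q k.+1) + rtilde P l k *: Q k.
Proof.
set qt := qtilde P l k.
pose D := X2P k - ptilde P l k *: (('X + qt%:P) * Q k.+1).
have DE : D = lfrac R l *: ('X * ('X * P l k) - P l k)
   - ptilde P l k *: ('X * Q k.+1 + qt *: Q k.+1).
  by rewrite /D X2PE mulrDl mul_polyC.
suff : D = rtilde P l k *: Q k.
  by rewrite -/(X2P k) => <-; rewrite addrC subrK.
have sD : (size D <= k.+1)%N.
  apply/leq_sizeP => j; rewrite leq_eqVlt => /predU1P[<-|kj].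
    rewrite DE coefB !coefZ coefB coefD coefZ subtopQ topQ coefXM /= subtopP.
    rewrite (coef_gt onP) // /ptilde /qt /qtilde -/(sumQ k.+1) -/(sumP k).
    by field; rewrite lcQ0.
  case: j kj => [|[|j]] // kj.
  rewrite DE coefB !coefZ coefB coefD coefZ !coefXM /=.
  have [<-|kj'] := eqVneq k j.
    rewrite [(P l k)`_k.+2](coef_gt onP) // [(Q k.+1)`_k.+2](coef_gt onQ) //.
    rewrite topP topQ /ptilde.
    by field; rewrite lcQ0.
  by rewrite !(coef_gt onP) ?(coef_gt onQ) ?(mulr0, addr0, subr0) //; lia.
have MD j : (j <= k)%N ->
    M (D * Q j) = L (P l k * Q j) - ptilde P l k * ((Q j)`_k / lcQ k.+1).
  move=> jk; rewrite /D mulrBl linearB /= cross_moment; congr (_ - _).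
  rewrite -scalerAl linearZ /=; congr (_ * _).
  have -> : ('X + qt%:P) * Q k.+1 * Q j = ('X * Q j + qt *: Q j) * Q k.+1.
    by rewrite -mul_polyC; ring.
  rewrite (moment_top onQ); last first.
    apply/leq_sizeP => i ki; rewrite coefD coefZ coefXM.
    by case: i ki => // i ki; rewrite !(coef_gt onQ) ?mulr0 ?addr0 //=; lia.
  by rewrite coefD coefZ coefXM /= [(Q j)`_k.+1](coef_gt onQ) // mulr0 addr0.
rewrite {1}(expansion_from onQ sD (leqnSn k)).
  rewrite big_nat1 MD // cross_diag topQ; congr (_ *: _).
  have [n0 d0] := lfrac_terms_neq0.
  by rewrite /rtilde /ptilde /pcoef /lfrac; field; rewrite lcP0 lcQ0 n0 d0.
move=> j jk; rewrite MD ?(ltnW jk) // cross_lower // (coef_gt onQ) //.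
by rewrite mul0r mulr0 subr0.
Qed.

(** Dually, the difference D has degree at most k - 1 and is orthogonal to P_j
    for j < k - 1; hence it is a multiple of P_(k-1), and is zero if k = 0. *)
Lemma two_term_lower k : Q k.+1 =
  (lfrac R l * (1 / ptilde P l k)) *: (('X - (qtilde P l k)%:P) * P l k)
    - (prev0 (acoef P l) k / acoef P l.-1 k * rtilde P l k) *: prev0 (P l) k.
Proof.
set qt := qtilde P l k.
have [n0 d0] := lfrac_terms_neq0.
(* The factor in front of (x - q) P_k is the one matching leading
   coefficients. *)
have -> : lfrac R l * (1 / ptilde P l k) = lcQ k.+1 / lcP k.
  by rewrite /ptilde /lfrac; field; rewrite lcP0 lcQ0 n0 d0.
pose D := Q k.+1 - (lcQ k.+1 / lcP k) *: ('X * P l k - qt *: P l k).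
rewrite mulrBl mul_polyC; apply/eqP; rewrite -subr_eq0 opprD opprK addrA -/D.
have sD : (size D <= k)%N.
  apply/leq_sizeP => j; rewrite leq_eqVlt /D coefB coefZ coefB coefZ.
  case/predU1P => [<-|].
    have := subtopQ k.+1; rewrite coefXM /= => ->.
    rewrite subtopP topP /qt /qtilde -/(sumQ k.+1) -/(sumP k).
    by field; rewrite lcP0.
  rewrite leq_eqVlt coefXM => /predU1P[<-|kj] /=.
    by rewrite topQ topP (coef_gt onP) // mulr0 subr0 divfK ?subrr.
  case: j kj => // j kj /=.
  by rewrite (coef_gt onQ) // !(coef_gt onP) ?(mulr0, subr0) //; lia.
have LD i : (i < k)%N -> L (D * P l i) =
    L (P l i * Q k.+1) - lcQ k.+1 / lcP k * ((P l i)`_k.-1 / lcP k).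
  move=> ik; rewrite /D mulrBl linearB /= mulrC; congr (_ - _).
  rewrite -scalerAl linearZ /=; congr (_ * _).
  have -> : ('X * P l k - qt *: P l k) * P l i =
      ('X * P l i - qt *: P l i) * P l k by rewrite -!mul_polyC; ring.
  rewrite (moment_top onP); last first.
    apply/leq_sizeP => j kj; rewrite coefB coefZ coefXM.
    by case: j kj => // j kj; rewrite !(coef_gt onP) ?mulr0 ?subr0 //=; lia.
  rewrite coefB coefZ coefXM [(P l i)`_k](coef_gt onP) // mulr0 subr0.
  by case: k ik {D sD qt}.
rewrite addr_eq0 -scaleNr; apply/eqP.
case: k => [|k] in qt D sD LD *.
  by rewrite scaler0; apply/eqP; rewrite -size_poly_eq0 -leqn0.
rewrite {1}(expansion_from onP sD (leqnSn k)).
  rewrite big_nat1 LD // cross_super2 /= topP; congr (_ *: _).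
  rewrite /rcoef /rtilde /ptilde /pcoef /acoef /lfrac /=.
  by field; rewrite !lcP0 !lcQ0 n0 d0.
move=> j jk; rewrite LD ?ltnS ?(ltnW jk) //= cross_upper // (coef_gt onP) //.
by rewrite mul0r mulr0 subr0.
Qed.

End Recurrences.

(** * The recurrence relations *)

Theorem theorem3p2 (R : realType) (zeta : R) (P : nat -> nat -> {poly R})
    (l k : nat) (zeta_gt0 : 0 < zeta) (l_ge1 : (1 <= l)%N)
    (orthoP : forall m : nat, orthonormal_polys zeta m (P m)) :
  (* (i) three-term relations *)
  ([/\ lfrac R l *: (('X^2 - 1) * P l k) =
        pcoef P l k *: P l.-1 k + qcoef P l k *: P l.-1 k.+1
        + rcoef P l k.+1 *: P l.-1 k.+2,
      P l.-1 k.+1 =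
        rcoef P l k *: prev0 (P l) k + qcoef P l k *: P l k
        + pcoef P l k.+1 *: P l k.+1,
      Pvec P l.-1 k.+1 =
        (map_mx polyC (Jtilde P l k))^T *m Pvec P l k
        + (pcoef P l k.+1 *: P l k.+1) *: last_col {poly R} k.+1,
      (lfrac R l *: ('X^2 - 1)) *: Pvec P l k =
        map_mx polyC (Jtilde P l k) *m Pvec P l.-1 k.+1
        + (rcoef P l k.+1 *: P l.-1 k.+2) *: last_col {poly R} k
    & qcoef P l k =
        lc P l.-1 k.+1 / lc P l k
        * \sum_(1 <= i < k.+2) (pzero P l i k.+1 - pzero P l.-1 i k.+1)])
  /\
  (* (ii) two-term relations *)
  (lfrac R l *: (('X^2 - 1) * P l k) =
      ptilde P l k *: (('X + (qtilde P l k)%:P) * P l.-1 k.+1)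
      + rtilde P l k *: P l.-1 k
   /\
   P l.-1 k.+1 =
      (lfrac R l * (1 / ptilde P l k)) *: (('X - (qtilde P l k)%:P) * P l k)
      - (prev0 (acoef P l) k / acoef P l.-1 k * rtilde P l k) *: prev0 (P l) k).
Proof.
case: l l_ge1 => // m l_ge1.
have [M ME onQ] := moment_functional zeta_gt0 (orthoP m).
have [L LE onP] := moment_functional zeta_gt0 (orthoP m.+1).
have M_ge0 (f : {poly R}) : (forall x, 0 <= f.[x]) -> 0 <= M f.
  by rewrite ME; exact: moment_ge0.
have L_ge0 (f : {poly R}) : (forall x, 0 <= f.[x]) -> 0 <= L f.
  by rewrite LE; exact: moment_ge0.
have LM f : L f = M (lfrac R m.+1 *: (('X^2 - 1) * f)).
  by rewrite LE ME moment_succ.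
split; split.
- exact: (three_term_upper l_ge1 onQ onP M_ge0 L_ge0 LM).
- exact: (three_term_lower l_ge1 onQ onP M_ge0 L_ge0 LM).
- exact: (vector_lower l_ge1 onQ onP M_ge0 L_ge0 LM).
- exact: (vector_upper l_ge1 onQ onP M_ge0 L_ge0 LM).
- exact: (qcoef_lower l_ge1 onQ onP M_ge0 L_ge0 LM).
- exact: (two_term_upper l_ge1 onQ onP M_ge0 L_ge0 LM).
- exact: (two_term_lower l_ge1 onQ onP M_ge0 L_ge0 LM).
Qed.
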